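(* Let $G$ be a non-cyclic finite group. If $\sigma(G)=\gamma(G)$, then $p=\sigma(G)-1$ is a prime and $G$ has a minimal cover consisting of normal subgroups of index $p$. In particular, $\gamma(G)=\gamma(G/G')=\sigma(G/G')$.
   Context: For a finite non-cyclic group $X$, a cover of $X$ is a collection $\mathcal C$ of proper subgroups of $X$ with $\bigcup_{H\in\mathcal C}H=X$; it is a minimal cover if $|\mathcal C|$ is as small as possible. The covering number $\sigma(X)$ is the size of a minimal cover of $X$. The normal covering number $\gamma(X)$ is the smallest integer $k$ such that $X$ contains $k$ proper subgroups $H_1,\dots,H_k$ with the property that every element of $X$ lies in $H_i^x$ for some $i\in\{1,\dots,k\}$ and $x\in X$ (where $H^x=x^{-1}Hx$). If $X$ is cyclic, one sets $\sigma(X)=\gamma(X)=\infty$, with the convention $n<\infty$ for every integer $n$. $G'$ denotes the derived (commutator) subgroup of $G$. *)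

(* Defs.v *)
From mathcomp Require Import all_boot all_fingroup all_solvable.

Set Implicit Arguments.
Unset Strict Implicit.
Unset Printing Implicit Defensive.

Local Open Scope group_scope.

Section Covers.

Variable gT : finGroupType.
Implicit Types (X H : {group gT}) (C D : {set {group gT}}).

Definition proper_subgroups X : {set {group gT}} :=
  [set H : {group gT} | H \proper X].

Definition is_cover X C : bool :=
  (C \subset proper_subgroups X) && (\bigcup_(H in C) H == X :> {set gT}).

Definition minimal_cover X C : bool :=
  is_cover X C && [forall D, is_cover X D ==> (#|C| <= #|D|)].

(* The subgroups H_1, ..., H_k are gathered in a set: repetitions would only
   increase k, so the minimum is unaffected. *)
Definition is_normal_cover X C : bool :=
  (C \subset proper_subgroups X) &&
  [forall g in X, exists H in C, exists x in X, g \in H :^ x].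

Lemma proper_subgroups_cover X :
  ~~ cyclic X -> is_cover X (proper_subgroups X).
Proof.
move=> ncX; rewrite /is_cover subxx /= eqEsubset; apply/andP; split.
  by apply/bigcupsP => H; rewrite inE => /proper_sub.
apply/subsetP => g Xg; apply/bigcupP; exists <[g]>%G; last exact: cycle_id.
rewrite inE properEneq cycle_subG Xg andbT.
by apply: contraNneq ncX => <-; exact: cycle_cyclic.
Qed.

Lemma cover_normal_cover X C : is_cover X C -> is_normal_cover X C.
Proof.
case/andP=> sCX /eqP defX; rewrite /is_normal_cover sCX /=.
apply/forall_inP => g; rewrite -{1}defX => /bigcupP[H CH Hg].
apply/exists_inP; exists H => //; apply/exists_inP; exists 1 => //.
by rewrite conjsg1.
Qed.

(* In both numbers below None stands for infinity, the value at cyclic groups;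
   for non-cyclic X the family of all proper subgroups is a legitimate starting
   point of the minimization by the two lemmas above. *)
Definition covering_number X : option nat :=
  if cyclic X then None
  else Some #|[arg min_(C < proper_subgroups X | is_cover X C) #|C|]|.

Definition normal_covering_number X : option nat :=
  if cyclic X then None
  else Some #|[arg min_(C < proper_subgroups X | is_normal_cover X C) #|C|]|.

Lemma covering_numberP X k :
  covering_number X = Some k <->
  ~~ cyclic X /\ exists2 C, minimal_cover X C & #|C| = k.
Proof.
rewrite /covering_number; case: (boolP (cyclic X)) => [cX | ncX].
  by split=> // -[].
case: arg_minnP => [|C covC minC]; first exact: proper_subgroups_cover.
split=> [[<-] | [_ [D /andP[covD /forall_inP minD] <-]]].
  by split=> //; exists C => //; rewrite /minimal_cover covC; apply/forall_inP.
by congr Some; apply/eqP; rewrite eqn_leq minC ?minD.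
Qed.

Lemma normal_covering_numberP X k :
  normal_covering_number X = Some k <->
  [/\ ~~ cyclic X, exists2 C, is_normal_cover X C & #|C| = k
    & forall D, is_normal_cover X D -> k <= #|D|].
Proof.
rewrite /normal_covering_number; case: (boolP (cyclic X)) => [cX | ncX].
  by split=> // -[].
case: arg_minnP => [|C covC minC].
  exact/cover_normal_cover/proper_subgroups_cover.
split=> [[<-] | [_ [D covD <-] minD]]; first by split=> //; exists C.
by congr Some; apply/eqP; rewrite eqn_leq minC ?minD.
Qed.

End Covers.

(* Main.v *)
Require Import Defs.
From mathcomp Require Import all_boot all_fingroup all_solvable.

Local Open Scope group_scope.

(** Let C be a minimal cover by maximal subgroups, of size k = sigma(G) =
    gamma(G).  Minimality of gamma gives each H in C an element of its core
    N_H lying in no other member of C.  For a subset J of C let L_J be the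
    intersection of the N_K for K in C outside J, and choose J minimal with
    L = L_J larger than N = L_0, the intersection of all the cores.  For H in J
    one finds L :&: H = N, as the core of another member of J centralizes L
    modulo N; hence L H = G and #|G : H| = #|L : N|.  Counting the cosets of N
    in x L, where x is the special element of some H in J, gives
    #|L : N| <= #|J| < k.  If some H in J were not normal, G / N would be a
    semidirect product of L / N and H / N having a normal cover with fewer than
    #|L : N| members.  So J provides two normal subgroups of the same prime
    index p < k, and the p + 1 subgroups of index p above their intersection
    form the required cover; they contain the derived subgroup. *)

(** * Elementwise criteria for covers and normal covers *)

Lemma is_coverP (gT : finGroupType) (G : {group gT}) (C : {set {group gT}}) :
  reflect ((forall H : {group gT}, H \in C -> H \proper G) /\
           (forall g, g \in G -> exists2 H : {group gT}, H \in C & g \in H))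
          (is_cover G C).
Proof.
apply: (iffP andP) => [[/subsetP sCG /eqP defG] | [sCG covG]].
  split=> [H /sCG | g]; first by rewrite inE.
  by rewrite -{1}defG => /bigcupP[H]; exists H.
split; first by apply/subsetP => H /sCG; rewrite inE.
rewrite eqEsubset; apply/andP; split.
  by apply/bigcupsP => H /sCG /proper_sub.
by apply/subsetP => g /covG[H CH Hg]; apply/bigcupP; exists H.
Qed.

Lemma is_normal_coverP (gT : finGroupType) (G : {group gT})
    (C : {set {group gT}}) :
  reflect ((forall H : {group gT}, H \in C -> H \proper G) /\
           (forall g, g \in G -> exists2 H : {group gT}, H \in C &
              exists2 x, x \in G & g ^ x \in H))
          (is_normal_cover G C).
Proof.
apply: (iffP andP) => [[/subsetP sCG /forall_inP covG] | [sCG covG]].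
  split=> [H /sCG | g /covG/exists_inP[H CH /exists_inP[x Gx]]].
    by rewrite inE.
  by rewrite mem_conjg => Hgx; exists H => //; exists x^-1; rewrite ?groupV.
split; first by apply/subsetP => H /sCG; rewrite inE.
apply/forall_inP => g /covG[H CH [x Gx Hgx]].
apply/exists_inP; exists H => //; apply/exists_inP; exists x^-1.
  by rewrite groupV.
by rewrite mem_conjgV.
Qed.

Arguments is_coverP {gT G C}.
Arguments is_normal_coverP {gT G C}.

(** * Transfer of covers between a group and its quotients *)

Section Quotients.

Variables (gT : finGroupType) (G N : {group gT}).
Hypothesis nsNG : N <| G.
Implicit Types (C : {set {group gT}}) (D : {set {group coset_of N}}).

Let cosetpre_properG (H : {group coset_of N}) :
  H \proper G / N -> (coset N @*^-1 H)%G \proper G.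
Proof.
by rewrite -cosetpre_proper quotientGK.
Qed.

Lemma cosetpre_cover D :
  is_cover (G / N)%G D ->
  is_cover G [set (coset N @*^-1 (H : {group coset_of N}))%G | H in D].
Proof.
have nNG := normal_norm nsNG.
case/is_coverP => sDG covG; apply/is_coverP.
split=> [_ /imsetP[H DH ->] | g Gg].
  by apply: cosetpre_properG; apply: sDG.
have [|H DH Hg] := covG (coset N g); first exact: mem_quotient.
exists (coset N @*^-1 H)%G; first exact: imset_f.
by rewrite mem_morphpre // (subsetP nNG).
Qed.

Lemma cosetpre_normal_cover D :
  is_normal_cover (G / N)%G D ->
  is_normal_cover G [set (coset N @*^-1 (H : {group coset_of N}))%G | H in D].
Proof.
have nNG := normal_norm nsNG.
case/is_normal_coverP => sDG covG; apply/is_normal_coverP.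
split=> [_ /imsetP[H DH ->] | g Gg].
  by apply: cosetpre_properG; apply: sDG.
have [|H DH [_ /morphimP[x nNx Gx ->] Hgx]] := covG (coset N g).
  exact: mem_quotient.
exists (coset N @*^-1 H)%G; first exact: imset_f.
have nNg := subsetP nNG g Gg.
by exists x => //; rewrite mem_morphpre ?groupJ // /= morphJ.
Qed.

Lemma quotient_cover C :
  (forall H, H \in C -> N \subset H) -> is_cover G C ->
  is_cover (G / N)%G [set (H / N)%G | H : {group gT} in C].
Proof.
move=> sNC /is_coverP[sCG covG]; apply/is_coverP.
split=> [_ /imsetP[H CH ->] | _ /morphimP[g nNg Gg ->]].
  have ltHG := sCG H CH.
  rewrite quotient_proper ?ltHG ?(normalS _ (proper_sub ltHG)) ?sNC //.
have [H CH Hg] := covG g Gg.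
by exists (H / N)%G; [apply/imsetP; exists H | apply: mem_quotient].
Qed.

End Quotients.

(** * Covers and maximal subgroups *)

Lemma cover_not_cyclic (gT : finGroupType) (G : {group gT}) C :
  is_cover G C -> ~~ cyclic G.
Proof.
case/is_coverP=> sCG covG; apply/cyclicP=> -[x defG].
have [|H CH Hx] := covG x; first by rewrite defG cycle_id.
by have /proper_subn/negP[] := sCG H CH; rewrite defG cycle_subG.
Qed.

(** An element of prime order, given by Cauchy, generates a nontrivial subgroup of [G / M], which
    maximality of [M] forces to be all of [G / M]. *)
Lemma maximal_normal_prime (gT : finGroupType) (G M : {group gT}) :
  maximal M G -> M <| G -> prime #|G : M|.
Proof.
move=> maxM nsMG; rewrite -card_quotient ?normal_norm //.
have: maximal [1 (coset_of M)]%G (G / M).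
  by rewrite /= -(trivg_quotient M) quotient_maximal.
case/maxgroupP; rewrite properE sub1G -indexg_gt1 indexg1 /= => Q_gt1 maxQ.
have [x Qx ox] := Cauchy (pdiv_prime Q_gt1) (pdiv_dvd _).
have: ~~ (<[x]> \proper G / M).
  apply/negP=> /maxQ/(_ (sub1G _)) x1; move: (pdiv_prime Q_gt1).
  by rewrite -ox orderE x1 cards1.
rewrite properEcard cycle_subG Qx -leqNgt => leQx.
suff ->: #|G / M| = #[x] by rewrite ox pdiv_prime.
by apply/eqP; rewrite eqn_leq leQx subset_leq_card ?cycle_subG.
Qed.

(** Each member is enlarged to a maximal subgroup; distinct members may merge, whence only an
    inequality of sizes. *)
Lemma maximal_cover (gT : finGroupType) (G : {group gT}) C :
  is_cover G C -> exists C' : {set {group gT}},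
  [/\ is_cover G C', #|C'| <= #|C| & forall M, M \in C' -> maximal M G].
Proof.
case/is_coverP=> sCG covG.
(* On [C] the default [H] is never reached, since a proper subgroup lies in a maximal one. *)
pose f (H : {group gT}) :=
  odflt H [pick M : {group gT} | maximal M G && (H \subset M)].
have fP H : H \in C -> maximal (f H) G /\ H \subset f H.
  move=> /sCG ltHG; rewrite /f; case: pickP => [M /andP[] // | noM].
  case: (maximal_exists (proper_sub ltHG)) => [eqHG | [M maxM sHM]].
    by rewrite eqHG properxx in ltHG.
  by have := noM M; rewrite maxM sHM.
exists (f @: C); split; last by move=> _ /imsetP[H /fP[maxH _] ->].
  apply/is_coverP; split=> [_ /imsetP[H /fP[maxH _] ->] | g /covG[H CH Hg]].
    exact: maxgroupp maxH.
  by exists (f H); rewrite ?imset_f //; case: (fP H CH) => _ /subsetP->.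
exact: leq_imset_card.
Qed.

(* If h in H has C_L(h) = 1, the whole coset Lh is conjugate to h; otherwise Lh
   lies in L C_H(l) for some l != 1 in L.  These subgroups and H form a normal
   cover of size at most #|L|, and one of them can be dropped, as H moves some
   l0. *)
Lemma small_normal_cover (gT : finGroupType) (G H L : {group gT}) :
    maximal H G -> ~~ (H <| G) -> L <| G -> ~~ (L \subset H) -> L :&: H = 1 ->
  exists2 D, is_normal_cover G D & #|D| < #|L|.
Proof.
move=> maxH nnHG nsLG sLH tiLH.
have [ltHG maxHG] := maxgroupP maxH; have sHG := proper_sub ltHG.
have nLH : H \subset 'N(L) := subset_trans sHG (normal_norm nsLG).
have defG : L * H = G.
  rewrite -norm_joinEr //; apply/eqP; rewrite eqEproper.
  rewrite join_subG normal_sub ?sHG //=.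
  apply/negP=> /maxHG/(_ (joing_subr _ _)).
  by move=> defH; case/negP: sLH; rewrite -defH joing_subl.
(* If [l] centralized [H] it would lie in the normalizer of [H], which is [H] itself by maximality
   and non-normality, contradicting [L :&: H = 1]. *)
have nCH l : l \in L^# -> 'C_H[l] \proper H.
  case/setD1P=> nl1 Ll; rewrite properEneq subsetIl andbT.
  apply/eqP=> defH; case/negP: nnHG.
  have sCH : H \subset 'C[l] by apply/setIidPl.
  have Gl : l \in G by rewrite (subsetP (normal_sub nsLG)).
  have nHl : l \in 'N(H) by rewrite (subsetP (cent_sub _)) // -sub_cent1.
  rewrite /normal sHG; apply: contraR nl1 => nnHG.
  suff Hl : l \in H by rewrite -in_set1 -[[set 1]]tiLH inE Ll.
  have ltNG : 'N_G(H) \proper G by rewrite properE subsetIl subsetI subxx.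
  rewrite -(maxHG _ ltNG) ?subsetI ?sHG ?normG //.
  by rewrite inE Gl.
have /subsetPn[l0 Ll0 nHl0] := sLH.
have nl0 : l0 \in L^#.
  by rewrite !inE Ll0 andbT; apply: contraNneq nHl0 => ->.
have /properP[_ [t Ht nCt]] := nCH _ nl0.
pose l1 := l0 ^ t.
have nl1 : l1 \in L^# by rewrite memJ_norm ?normD1 ?(subsetP nLH).
have nel : l1 != l0.
  apply: contra nCt => /eqP l01; rewrite inE Ht cent1C /=.
  by apply/cent1P/commgP/conjg_fixP.
pose f l := (L <*> 'C_H[l])%G.
(* The size is at most 1 for [H] plus [#|L| - 2] for the nontrivial elements of [L] other than
   [l0]. *)
exists (H |: f @: (L^# :\ l0)); last first.
  rewrite (cardsD1 1 L) group1 ltnS (cardsD1 l0 L^#) nl0 cardsU1.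
  by rewrite leq_add ?leq_b1 ?leq_imset_card.
have fG l : l \in L^# -> f l \proper G.
  move=> nl; have sCH := subsetIl H 'C[l].
  rewrite properEneq join_subG normal_sub ?(subset_trans sCH) //= andbT.
  apply/eqP=> defG'; have /proper_subn/negP[] := nCH l nl.
  have <- : (L * 'C_H[l]) :&: H = 'C_H[l].
    by rewrite setIC -group_modr // setIC tiLH mul1g.
  rewrite -norm_joinEr ?(subset_trans sCH) // defG'.
  by rewrite subsetI sHG subxx.
have Df l h : l \in L^# -> h \in H -> h \in 'C[l] -> L :* h \subset f l.
  move=> nl Hh Ch; rewrite mul_subG ?joing_subl // sub1set.
  by apply: (subsetP (joing_subr _ _)); rewrite inE Hh.
apply/is_normal_coverP; split=> [K | g].
  by case/setU1P=> [-> | /imsetP[l /setD1P[_ nl] ->]] //; apply: fG.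
rewrite -{1}defG => /mulsgP[l h Ll Hh ->].
have [Ch1 | /trivgPn[l' /setIP[Ll' Cl'] nl']] := eqVneq 'C_L[h] 1.
  have: l * h \in h ^: L.
    (* The class lies in the coset, and both have [#|L|] elements. *)
    suff -> : h ^: L = L :* h by rewrite mem_rcoset mulgK.
    apply/eqP; rewrite eqEcard card_rcoset -index_cent1 Ch1 indexg1 leqnn andbT.
    apply/subsetP=> _ /imsetP[z Lz ->].
    rewrite mem_rcoset /conjg -!mulgA groupMl ?groupV //.
    have -> : h * (z * h^-1) = z ^ h^-1 by rewrite conjgE invgK.
    by rewrite memJ_norm // groupV (subsetP nLH).
  case/imsetP=> z Lz ->; exists H; first exact: setU11.
  exists z^-1; first by rewrite groupV (subsetP (normal_sub nsLG)).
  by rewrite conjgK.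
have nl : l' \in L^# by rewrite !inE nl'.
have Ch : h \in 'C[l'] by rewrite cent1C.
have lhL : l * h \in L :* h by rewrite mem_rcoset mulgK.
have [eql | neql] := eqVneq l' l0; last first.
  exists (f l'); last first.
    by exists 1; rewrite ?conjg1 ?group1 ?(subsetP (Df _ _ nl Hh Ch)).
  by apply/setU1P; right; apply/imsetP; exists l'; rewrite // in_setD1 neql.
(* Conjugation by [t] carries the dropped [f l0] to [f l1]: [h ^ t] centralizes [l1], and [l ^ t]
   stays in [L]. *)
exists (f l1).
  by apply/setU1P; right; apply/imsetP; exists l1; rewrite // in_setD1 nel.
exists t; first exact: (subsetP sHG).
have Ch' : h ^ t \in 'C[l1] by rewrite /l1 -eql cent1J memJ_conjg.
apply: (subsetP (Df _ _ nl1 (groupJ Hh Ht) Ch')).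
by rewrite conjMg mem_rcoset mulgK memJ_norm // (subsetP nLH).
Qed.

(** * Cores of the members of a minimal cover *)

Section MinimalCover.

Variables (gT : finGroupType) (G : {group gT}) (C : {set {group gT}}).
Hypothesis covC : is_cover G C.
Hypothesis maxC : forall H, H \in C -> maximal H G.
Hypothesis minC : forall D, is_normal_cover G D -> #|C| <= #|D|.

Let sCG H : H \in C -> H \subset G.
Proof. by move/maxC/maxgroupp/proper_sub. Qed.

Let coreN H : H \in C -> gcore H G <| G.
Proof. by move/sCG/gcore_normal. Qed.

(* As C minus H is not a normal cover, some g in G has no conjugate in the
   other members of C, hence all its conjugates lie in H. *)
Lemma core_witness H : H \in C ->
  exists2 x, x \in gcore H G & forall K, K \in C -> K != H -> x \notin K.
Proof.
move=> CH; have [sCprop covG] := is_coverP covC.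
have: ~~ is_normal_cover G (C :\ H).
  by apply/negP=> /minC; rewrite (cardsD1 H C) CH ltnn.
rewrite /is_normal_cover negb_and => /orP[/negP[] | /forall_inPn[g Gg ncov]].
  by apply/subsetP=> K /setD1P[_ /sCprop]; rewrite inE.
have notK K y : K \in C -> K != H -> y \in G -> g ^ y \notin K.
  move=> CK neKH Gy; apply: contra ncov => Kgy.
  apply/exists_inP; exists K; first by rewrite in_setD1 neKH.
  apply/exists_inP; exists y^-1; first by rewrite groupV.
  by rewrite mem_conjgV.
exists g => [|K CK neKH]; last by rewrite -[g]conjg1 notK.
apply/bigcapP=> y Gy; rewrite mem_conjg.
have [|K CK Kg] := covG (g ^ y^-1); first by rewrite groupJ ?groupV.
have [<- // | neKH] := eqVneq K H.
by rewrite (negPf (notK K _ CK neKH _)) ?groupV in Kg.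
Qed.

(** The factor [G] matters at [J = C], where the intersection is empty and would be the whole
    type. *)
Let L (J : {set {group gT}}) :=
  (G :&: \bigcap_(H in C :\: J) gcore H G)%G.

Let memL (J : {set {group gT}}) x :
  reflect (x \in G /\ forall H, H \in C -> H \notin J -> x \in gcore H G)
          (x \in L J).
Proof.
apply: (iffP setIP) => -[Gx Jx]; split=> //.
  by move=> H CH nJH; apply: (bigcapP Jx); rewrite inE nJH.
by apply/bigcapP=> H /setDP[CH nJH]; apply: Jx.
Qed.

Let L_normal J : L J <| G.
Proof.
rewrite /normal subsetIl normsI ?normG // norms_bigcap //.
by apply/bigcapsP=> H _; apply: gcore_norm.
Qed.

Let L0_sub J : L set0 \subset L J.
Proof.
apply/subsetP=> x /memL[Gx Nx]; apply/memL; split=> // H CH _.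
by rewrite Nx ?inE.
Qed.

Let L0_core H : H \in C -> L set0 \subset gcore H G.
Proof. by move=> CH; apply/subsetP=> x /memL[_]; apply; rewrite ?inE. Qed.

(** With [x] the witness of [H] and [y] in [L [set H]], a member [K != H] containing [x * y] would
    contain [y], hence [x]. So [x * y], and thus [y], is in [H]; normality then puts [L [set H]] in
    the core of [H]. *)
Let L1 H : H \in C -> L [set H] = L set0.
Proof.
move=> CH; apply/val_inj/eqP; rewrite eqEsubset L0_sub andbT /=.
have [x Hx nKx] := core_witness H CH.
have [_ covG] := is_coverP covC.
have sLH : L [set H] \subset H.
  apply/subsetP=> y /memL[Gy Ky]; have Hx' := subsetP (gcore_sub _ _) x Hx.
  have [|K CK Kxy] := covG (x * y).
    by rewrite groupM // (subsetP (sCG H CH)).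
  have [eqKH | neKH] := eqVneq K H; first by rewrite -(groupMl y Hx') -eqKH.
  have Ky' : y \in K by rewrite (subsetP (gcore_sub K G)) ?Ky ?inE.
  by case/negP: (nKx K CK neKH); rewrite -(groupMr x Ky').
have sLcH : L [set H] \subset gcore H G.
  by rewrite gcore_max ?normal_norm.
apply/subsetP=> y Ly; have [Gy Ky] := memL _ _ Ly.
apply/memL; split=> // K CK _.
have [-> | neKH] := eqVneq K H; first exact: (subsetP sLcH).
by rewrite Ky ?inE.
Qed.

Lemma two_normal_maximal :
  exists H1 H2 : {group gT},
    [/\ H1 != H2, maximal H1 G /\ maximal H2 G, H1 <| G /\ H2 <| G,
        #|G : H1| = #|G : H2| & #|G : H1| < #|C|].
Proof.
have [_ covG] := is_coverP covC.
pose P (J : {set {group gT}}) := (J \subset C) && (L J != L set0).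
have P_C : P C.
  rewrite /P subxx /=; have [H CH _] := covG 1 (group1 G).
  apply: contraTneq (maxgroupp (maxC H CH)) => eqLC.
  rewrite properE negb_and negbK; apply/orP; right.
  apply: subset_trans (gcore_sub H G); apply: subset_trans (L0_core H CH).
  rewrite -eqLC; apply/subsetP=> x Gx; apply/memL; split=> // K CK /negP[].
  exact: CK.
have [J /andP[sJC neJN] minJ] :=
  arg_minnP (fun J : {set {group gT}} => #|J|) P_C.
(* The left side is [L (J :\ H)], which is [L set0] by minimality of [J]. *)
have LD1 H : H \in J -> L J :&: gcore H G = L set0.
  move=> JH; have CH := subsetP sJC H JH.
  have /eqP <- : L (J :\ H) == L set0.
    apply: contraTT (leqnn #|J|) => neL; rewrite -ltnNge.
    rewrite {2}(cardsD1 H J) JH ltnS minJ // /P neL andbT.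
    exact: subset_trans (subD1set _ _) sJC.
  apply/setP=> x; apply/setIP/memL => [[/memL[Gx Jx] Hx] | [Gx Jx]].
    split=> // K CK; rewrite !inE negb_and negbK => /orP[/eqP-> //|].
    exact: Jx.
  split; last by rewrite Jx ?inE ?eqxx.
  by apply/memL; split=> // K CK nJK; rewrite Jx // !inE (negPf nJK) andbF.
have other H : H \in J -> exists2 K, K \in J & K != H.
  move=> JH; have [J0 | [K /setD1P[neKH JK]]] := set_0Vmem (J :\ H).
    case/negP: neJN; rewrite -(setD1K JH) J0 setU0.
    by rewrite L1 // (subsetP sJC).
  by exists K.
have [H0 JH0] : exists H, H \in J.
  have [J0 | [H JH]] := set_0Vmem J; last by exists H.
  by rewrite J0 eqxx in neJN.
(* The commutator of [L J :&: H] with the core of [K] lies in [L set0], so this core normalizes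
   [L J :&: H], as [H] does. The core of [K] is not inside [H], so [L J :&: H] is normal in [G] and
   lies in the core of [H]. *)
have tiLH H : H \in J -> L J :&: H = L set0.
  move=> JH; have [K JK neKH] := other H JH.
  have [CH CK] := (subsetP sJC H JH, subsetP sJC K JK).
  have sNH := subset_trans (L0_core H CH) (gcore_sub H G).
  have [x Kx nx] := core_witness K CK.
  have nHx : x \notin H by rewrite nx // eq_sym.
  have nLH : gcore K G \subset 'N(L J :&: H).
    rewrite -commg_subr; apply: subset_trans (_ : L set0 \subset _); last first.
      by rewrite subsetI L0_sub sNH.
    rewrite -(LD1 K JK); apply: subset_trans (commgS _ (subsetIl _ _)) _.
    rewrite subsetI commg_subl commg_subr.
    have [nsL nsK] := (L_normal J, coreN K CK).
    apply/andP; split.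
      exact: subset_trans (normal_sub nsK) (normal_norm nsL).
    exact: subset_trans (normal_sub nsL) (normal_norm nsK).
  apply/eqP; rewrite eqEsubset [X in _ && X]subsetI L0_sub sNH andbT.
  rewrite -(LD1 H JH) subsetI subsetIl gcore_max ?subsetIr //=.
  have [_ maxH] := maxgroupP (maxC H CH).
  have nH : H \subset 'N(L J :&: H).
    rewrite normsI ?normG // (subset_trans (sCG H CH)) //.
    exact: normal_norm.
  apply: contraNT nHx => nN.
  have ltNG : 'N_G(L J :&: H) \proper G.
    by rewrite properE subsetIl subsetI subxx.
  have sHN : H \subset 'N_G(L J :&: H) by rewrite subsetI sCG.
  rewrite -(maxH _ ltNG sHN) inE (subsetP nLH) // andbT.
  exact: subsetP (normal_sub (coreN K CK)) x Kx.
have sLH H : H \in J -> ~~ (L J \subset H).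
  move=> JH; apply: contra neJN => /setIidPl eqL; apply/eqP/val_inj.
  by rewrite /= -(tiLH H) // eqL.
have indexJ H : H \in J -> #|G : H| = #|L J : L set0|.
  move=> JH; have CH := subsetP sJC H JH.
  suff defG : H * L J = G by rewrite -(tiLH H JH) indexgI -defG indexMg.
  have [_ maxH] := maxgroupP (maxC H CH).
  have nLH := subset_trans (sCG H CH) (normal_norm (L_normal J)).
  rewrite -norm_joinEl //; apply/eqP; rewrite eqEproper.
  rewrite join_subG (normal_sub (L_normal J)) sCG //=.
  apply: contra (sLH H JH) => /maxH/(_ (joing_subl _ _)) <-.
  exact: joing_subr.
have leJ : #|L J : L set0| <= #|J|.
  have CH := subsetP sJC H0 JH0.
  have [x Hx nx] := core_witness H0 CH.
  (* If [x * l] is in [K], then [K] is in [J] and [f K] is the coset of [l]; so [f] maps [J] onto a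
     family containing all cosets. *)
  pose f (K : {group gT}) := L J :&: x^-1 *: K.
  rewrite -card_lcosets; apply: leq_trans (leq_imset_card f J).
  apply/subset_leq_card/subsetP=> _ /lcosetsP[l Ll ->].
  have Gl := subsetP (normal_sub (L_normal J)) l Ll.
  have Gx : x \in G by rewrite (subsetP (normal_sub (coreN H0 CH))).
  have [|K CK Kxl] := covG (x * l); first exact: groupM.
  have JK : K \in J.
    apply: contraT => nJK; have [_ /(_ K CK nJK) Kl] := memL _ _ Ll.
    have neKH : K != H0 by apply: contraNneq nJK => ->.
    case/negP: (nx K CK neKH).
    by rewrite -(groupMr x (subsetP (gcore_sub K G) l Kl)).
  apply/imsetP; exists K => //; apply/setP=> z.
  rewrite -(tiLH K JK) mem_lcoset !(in_setI _ (L J)) mem_lcoset invgK.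
  by rewrite (groupMl z) ?groupV // -(groupMl (l^-1 * z) Kxl) mulgA mulgK.
have [K0 JK0 neKH] := other H0 JH0.
have ltJC : #|J| < #|C|.
  apply: proper_card; rewrite properEneq sJC andbT.
  (* If [J = C], then [L J = G], so [tiLH] makes every member of [J] equal to [L set0]. *)
  apply: contraNneq neKH => eqJC.
  have LG : L J = G.
    apply/val_inj/setIidPl/subsetP=> x Gx; apply/bigcapP=> K.
    by rewrite eqJC setDv inE.
  have defJ H : H \in J -> H = L set0.
    move=> JH; apply/group_inj/(etrans _ (tiLH H JH))/esym/setIidPr.
    by rewrite LG sCG ?(subsetP sJC).
  by rewrite (defJ K0) // (defJ H0).
have normJ H : H \in J -> H <| G.
  move=> JH; have CH := subsetP sJC H JH; have sHG := sCG H CH.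
  have [nsNG nsLG] := (L_normal set0, L_normal J).
  have sNH := subset_trans (L0_core H CH) (gcore_sub H G).
  have nsNH := normalS sNH sHG nsNG.
  have nsNL := normalS (L0_sub J) (normal_sub nsLG) nsNG.
  apply: contraT => nnHG.
  have [||||| D covD ltD] :=
    @small_normal_cover _ (G / L set0) (H / L set0) (L J / L set0).
  - by rewrite quotient_maximal // maxC.
  - apply: contra nnHG; rewrite -cosetpre_normal !quotientGK //.
  - exact: quotient_normal.
  - by rewrite quotientSGK ?sLH ?normal_norm.
  - by rewrite -quotientGI ?L0_sub // tiLH // trivg_quotient.
  have := minC _ (cosetpre_normal_cover _ _ _ nsNG _ covD).
  rewrite leqNgt (leq_ltn_trans (leq_imset_card _ _)) //.
  rewrite (ltn_trans ltD) // card_quotient ?normal_norm //.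
  exact: leq_ltn_trans leJ ltJC.
exists K0, H0; split; rewrite ?normJ ?maxC ?(subsetP sJC) ?indexJ //.
by rewrite (leq_ltn_trans leJ).
Qed.

End MinimalCover.

(* The preimages of the p + 1 lines of G / (H1 :&: H2), an elementary abelian
   group of order p ^ 2. *)
Lemma prime_index_cover (gT : finGroupType) (G H1 H2 : {group gT}) p :
    prime p -> H1 != H2 -> maximal H1 G -> maximal H2 G ->
    H1 <| G -> H2 <| G -> #|G : H1| = p -> #|G : H2| = p ->
  exists C : {set {group gT}}, [/\ is_cover G C, #|C| <= p.+1
    & forall K, K \in C -> G^`(1) \subset K /\ #|G : K| = p].
Proof.
move=> p_pr neH12 max1 max2 ns1 ns2 i1 i2.
have der_sub (H : {group gT}) : H <| G -> #|G : H| = p -> G^`(1) \subset H.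
  move=> nsH iH; apply: der1_min (normal_norm nsH) (cyclic_abelian _).
  by rewrite prime_cyclic // card_quotient ?normal_norm // iH.
have expp (H : {group gT}) x :
    H <| G -> #|G : H| = p -> x \in G -> x ^+ p \in H.
  move=> nsH iH Gx; have nHx := subsetP (normal_norm nsH) x Gx.
  apply: coset_idr; first by rewrite groupX.
  rewrite morphX // -iH -card_quotient ?normal_norm //.
  by rewrite expg_cardG // mem_quotient.
pose T := (H1 :&: H2)%G.
have nsTG : T <| G by apply: normalI.
have nTG := normal_norm nsTG.
have sG'T : G^`(1) \subset T by rewrite subsetI !der_sub.
(* Distinct normal maximal subgroups have product [G], so [T] has index [p] in [H1]. *)
have oQ : #|G / T| = (p ^ 2)%N.
  rewrite card_quotient // -(Lagrange_index (normal_sub ns1) (subsetIl H1 H2)).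
  rewrite i1 indexgI -indexMg.
  rewrite (mulg_normal_maximal ns2 max2 (normal_sub ns1)) ?i2 //.
  have [_ maxH1] := maxgroupP max1.
  apply: contra neH12 => s12; apply/eqP; symmetry.
  exact: group_inj (maxH1 _ (maxgroupp max2) s12).
have abQ : p.-abelem (G / T).
  rewrite abelemE // sub_der1_abelian //.
  apply/exponentP=> _ /morphimP[x nTx Gx ->].
  by rewrite -morphX //= coset_id // inE !expp.
have E2 : (G / T)%G \in 'E_p^2(G / T).
  by rewrite pnElemE // !inE subxx abQ oQ /=.
have oE := card_p1Elem_p2Elem E2.
have covQ : is_cover (G / T)%G 'E_p^1(G / T).
  apply/is_coverP; split=> [K | q Qq].
    rewrite p1ElemE // !inE => /andP[sKQ /eqP oK].
    by rewrite properEcard sKQ oK oQ -{1}(expn1 p) ltn_exp2l // prime_gt1.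
  (* The identity only needs some line to exist; any other element has order [p] and generates
     one. *)
  have [-> | nt_q] := eqVneq q 1.
    have /card_gt0P[K EK] : 0 < #|'E_p^1(G / T)| by rewrite oE.
    by exists K.
  exists <[q]>%G; last exact: cycle_id.
  by rewrite p1ElemE // !inE cycle_subG Qq -orderE (abelem_order_p abQ) ?eqxx.
exists [set (coset T @*^-1 (K : {group coset_of T}))%G | K in 'E_p^1(G / T)].
split; first exact: cosetpre_cover.
  by rewrite -oE leq_imset_card.
move=> _ /imsetP[K + ->]; rewrite p1ElemE // !inE => /andP[sKQ /eqP oK].
split; first by apply: subset_trans sG'T (sub_cosetpre K).
have iK : #|G / T : K| = p.
  by apply/eqP; rewrite -(eqn_pmul2l (cardG_gt0 K)) Lagrange // oQ oK.
by rewrite -iK -index_cosetpre quotientGK.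
Qed.

(** * Covering numbers of the group and of its abelianization *)

Theorem corollary3 (gT : finGroupType) (G : {group gT}) :
  ~~ cyclic G ->
  covering_number G = normal_covering_number G ->
  (exists p : nat,
    [/\ covering_number G = Some p.+1,
        prime p
      & exists2 C : {set {group gT}},
          minimal_cover G C
          & forall H : {group gT}, H \in C -> H <| G /\ #|G : H| = p]) /\
  (normal_covering_number G = normal_covering_number (G / G^`(1))%G /\
   normal_covering_number (G / G^`(1))%G = covering_number (G / G^`(1))%G).
Proof.
move=> ncG eq_cov.
have [k cov_k] : exists k, covering_number G = Some k.
  by rewrite /covering_number (negPf ncG); eexists.
have ncov_k := esym eq_cov; rewrite cov_k in ncov_k.
have [_ [C0 /andP[covC0 _] oC0]] := (covering_numberP _ _).1 cov_k.
have [_ _ minG] := (normal_covering_numberP _ _).1 ncov_k.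
have [C [covC leC maxC]] := maximal_cover _ _ _ covC0.
have oC : #|C| = k.
  by apply/eqP; rewrite eqn_leq -{1}oC0 leC minG ?cover_normal_cover.
have [|H1 [H2 [neH12 [max1 max2] [ns1 ns2] i12 ltp]]] :=
  two_normal_maximal _ _ _ covC maxC.
  by move=> D; rewrite oC; apply: minG.
have p_pr := maximal_normal_prime _ _ _ max1 ns1.
set p := #|G : H1| in p_pr ltp.
have [D [covD leD Dp]] :=
  prime_index_cover _ _ _ _ _ p_pr neH12 max1 max2 ns1 ns2 erefl (esym i12).
have oD : #|D| = k.
  apply/eqP; rewrite eqn_leq minG ?cover_normal_cover // andbT.
  by rewrite (leq_trans leD) // -oC.
(* The bound [p < #|C|] meets the size [p.+1] of the family of lines. *)
have kp : k = p.+1 by apply/eqP; rewrite eqn_leq -{1}oD leD -oC.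
have sDG K : K \in D -> K \subset G.
  by have [sDG _] := is_coverP covD; move/sDG/proper_sub.
have nsG'G := der_normal 1 G.
have covQ : is_cover (G / G^`(1))%G [set (K / G^`(1))%G | K : {group gT} in D].
  by apply: quotient_cover => // K /Dp[].
have leQ : #|[set (K / G^`(1))%G | K : {group gT} in D]| <= k.
  by rewrite -oD leq_imset_card.
have ncQ := cover_not_cyclic _ _ _ covQ.
(* Preimages of normal covers are normal covers of [G], so [k] is a lower bound for the quotient
   too; the image of [D] attains it. *)
have minQ (E : {set {group coset_of G^`(1)}}) :
    is_normal_cover (G / G^`(1))%G E -> k <= #|E|.
  move=> covE; apply: leq_trans (leq_imset_card _ _).
  by apply: minG; apply: cosetpre_normal_cover covE.
have oQ : #|[set (K / G^`(1))%G | K : {group gT} in D]| = k.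
  by apply/eqP; rewrite eqn_leq leQ minQ ?cover_normal_cover.
split.
  exists p; split; rewrite -?kp //; exists D.
    rewrite /minimal_cover covD; apply/forall_inP=> E covE.
    by rewrite oD minG ?cover_normal_cover.
  by move=> K DK; have [sG'K iK] := Dp K DK; rewrite sub_der1_normal ?sDG.
have -> : normal_covering_number (G / G^`(1))%G = Some k.
  apply/normal_covering_numberP; split=> //.
  exists [set (K / G^`(1))%G | K : {group gT} in D] => //.
  by rewrite ?cover_normal_cover.
split=> //; apply/esym/covering_numberP; split=> //.
exists [set (K / G^`(1))%G | K : {group gT} in D] => //.
rewrite /minimal_cover covQ; apply/forall_inP=> E covE.
by rewrite oQ minQ ?cover_normal_cover.
Qed.
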